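(* Let $n\geq 1$ be an integer, let $A_1,\ldots ,A_n$ be residuated lattices, and let $A=\prod _{i=1}^nA_i$ with componentwise operations. Then the following are equivalent: (1) $A$ has the Boolean Lifting Property (BLP); (2) for every $i\in \{1,\ldots ,n\}$, $A_i$ has BLP.
   Context: A residuated lattice is a commutative integral bounded one: a structure $(A,\vee ,\wedge ,\odot ,\rightarrow ,0,1)$ such that $(A,\vee ,\wedge ,0,1)$ is a bounded lattice, $(A,\odot ,1)$ is a commutative monoid, and $a\leq b\rightarrow c$ iff $a\odot b\leq c$ for all $a,b,c$. Write $a\leftrightarrow b=(a\rightarrow b)\wedge (b\rightarrow a)$. $\mathcal{B}(A)$ is the set of complemented elements of the bounded lattice reduct of $A$. A filter of $A$ is a nonempty subset closed under $\odot$ and upward closed. For a filter $F$, $A/F$ is the quotient residuated lattice by the congruence $a\equiv b$ iff $a\leftrightarrow b\in F$, with classes $a/F$. $F$ has BLP iff for every $f\in \mathcal{B}(A/F)$ there is $e\in \mathcal{B}(A)$ with $e/F=f$. $A$ has BLP iff all its filters have BLP. *)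

(* Defs.v *)
From HB Require Import structures.
From mathcomp Require Import all_boot all_order.
From mathcomp Require Import generic_quotient boolp classical_sets.

Set Implicit Arguments.
Unset Strict Implicit.
Unset Printing Implicit Defensive.

Import Order.TTheory.

Declare Scope rl_scope.
Delimit Scope rl_scope with RL.

Local Open Scope order_scope.
Local Open Scope quotient_scope.

(* The unit of the monoid is the top element (integrality). The bounds \bot
   and \top may coincide, so the one-element residuated lattice is included. *)
#[key="T"]
HB.mixin Record TBLattice_isResiduated (d : Order.disp_t) T
    of Order.TBLattice d T := {
  rl_mul : T -> T -> T;
  rl_imp : T -> T -> T;
  rl_mulA : associative rl_mul;
  rl_mulC : commutative rl_mul;
  rl_mul1 : left_id (\top : T) rl_mul;
  rl_residuation : forall a b c : T, (a <= rl_imp b c) = (rl_mul a b <= c)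
}.

#[short(type="residuatedLatticeType")]
HB.structure Definition ResiduatedLattice (d : Order.disp_t) :=
  { T of Order.TBLattice d T & TBLattice_isResiduated d T }.

Notation "a ⊙ b" := (rl_mul a b) (at level 40, left associativity) : rl_scope.
Notation "a ⇒ b" := (rl_imp a b) (at level 55, right associativity) : rl_scope.
Local Open Scope rl_scope.

Definition rl_iff d (A : residuatedLatticeType d) (a b : A) : A :=
  (a ⇒ b) `&` (b ⇒ a).

Notation "a ⇔ b" := (rl_iff a b) (at level 56, no associativity) : rl_scope.

Section BasicTheory.
Variables (d : Order.disp_t) (A : residuatedLatticeType d).
Implicit Types a b c : A.

Lemma rl_mul1r a : a ⊙ \top = a.
Proof. by rewrite rl_mulC rl_mul1. Qed.

Lemma rl_mp a b : (a ⇒ b) ⊙ a <= b.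
Proof. by rewrite -rl_residuation. Qed.

Lemma rl_mul_monor a b c : a <= b -> a ⊙ c <= b ⊙ c.
Proof. by move=> ab; rewrite -rl_residuation (le_trans ab)// rl_residuation. Qed.

Lemma rl_mul_monol a b c : a <= b -> c ⊙ a <= c ⊙ b.
Proof. by move=> ab; rewrite ![c ⊙ _]rl_mulC rl_mul_monor. Qed.

Lemma rl_mul_lel a b : a ⊙ b <= a.
Proof. by rewrite -[leRHS]rl_mul1r rl_mul_monol// lex1. Qed.

Lemma rl_mul_ler a b : a ⊙ b <= b.
Proof. by rewrite rl_mulC rl_mul_lel. Qed.

Lemma rl_imp_top a b : (a ⇒ b == \top) = (a <= b).
Proof. by rewrite -le1x rl_residuation rl_mul1. Qed.

Lemma rl_imp_mul a b c : a ⊙ b ⇒ c = a ⇒ b ⇒ c.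
Proof.
apply/le_anti/andP; split.
  by rewrite !rl_residuation -rl_mulA rl_mp.
by rewrite rl_residuation rl_mulA -!rl_residuation.
Qed.

Lemma rl_imp_trans a b c : (a ⇒ b) ⊙ (b ⇒ c) <= a ⇒ c.
Proof.
rewrite rl_residuation [(a ⇒ b) ⊙ _]rl_mulC -rl_mulA.
exact: le_trans (rl_mul_monol _ (rl_mp _ _)) (rl_mp _ _).
Qed.

End BasicTheory.

(* An element of a bounded lattice may have several complements when the
   lattice is not distributive; only the existence of one is required. *)
Definition complemented_elements d (L : tbLatticeType d) : set L :=
  [set x | (exists y : L, x `&` y = \bot /\ x `|` y = \top)%O]%classic.

Notation "'\B' ( L )" := (@complemented_elements _ L%type)
  (at level 8, format "'\B' ( L )") : rl_scope.

(* The whole lattice is a filter. *)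
Record rl_filter d (A : residuatedLatticeType d) := RLFilter {
  rl_filter_set :> A -> Prop;
  rl_filter_nonempty : exists a, rl_filter_set a;
  rl_filter_mul : forall a b,
    rl_filter_set a -> rl_filter_set b -> rl_filter_set (a ⊙ b);
  rl_filter_up : forall a b, rl_filter_set a -> a <= b -> rl_filter_set b
}.

Section Quotient.
Variables (d : Order.disp_t) (A : residuatedLatticeType d) (F : rl_filter A).
Implicit Types a b c : A.

Lemma rl_filter_top : F \top.
Proof.
by have [a Fa] := rl_filter_nonempty F; apply: rl_filter_up Fa (lex1 _).
Qed.

Lemma rl_filter_and (P Q R : A) :
  P ⊙ Q <= R -> R <= P -> R <= Q -> F R <-> F P /\ F Q.
Proof.
move=> PQR RP RQ; split=> [FR|[FP FQ]].
  by split; [exact: rl_filter_up FR RP|exact: rl_filter_up FR RQ].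
by apply: rl_filter_up PQR; apply: rl_filter_mul.
Qed.

Lemma rl_filter_iff a b : F (a ⇔ b) <-> F (a ⇒ b) /\ F (b ⇒ a).
Proof.
by apply: rl_filter_and; rewrite ?leIl ?leIr// lexI rl_mul_lel rl_mul_ler.
Qed.

Lemma rl_filter_le a b : a <= b -> F (a ⇒ b).
Proof. by rewrite -rl_imp_top => /eqP ->; exact: rl_filter_top. Qed.

Lemma rl_filter_imp_trans b a c : F (a ⇒ b) -> F (b ⇒ c) -> F (a ⇒ c).
Proof.
by move=> ab bc; apply: rl_filter_up (rl_imp_trans a b c); exact: rl_filter_mul.
Qed.

Lemma rl_filter_imp_meet a b c : F (a ⇒ b `&` c) <-> F (a ⇒ b) /\ F (a ⇒ c).
Proof.
apply: rl_filter_and.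
- rewrite rl_residuation lexI; apply/andP; split.
    by apply: le_trans (rl_mp a b); rewrite rl_mul_monor// rl_mul_lel.
  by apply: le_trans (rl_mp a c); rewrite rl_mul_monor// rl_mul_ler.
- by rewrite rl_residuation (le_trans (rl_mp _ _))// leIl.
- by rewrite rl_residuation (le_trans (rl_mp _ _))// leIr.
Qed.

Lemma rl_filter_imp_join a b c : F (a `|` b ⇒ c) <-> F (a ⇒ c) /\ F (b ⇒ c).
Proof.
apply: rl_filter_and.
- rewrite rl_residuation rl_mulC -rl_residuation leUx !rl_residuation.
  apply/andP; split.
    by rewrite rl_mulC (le_trans _ (rl_mp a c))// rl_mul_monor// rl_mul_lel.
  by rewrite rl_mulC (le_trans _ (rl_mp b c))// rl_mul_monor// rl_mul_ler.
- rewrite rl_residuation (le_trans _ (rl_mp (a `|` b) c))//.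
  by rewrite rl_mul_monol// leUl.
- rewrite rl_residuation (le_trans _ (rl_mp (a `|` b) c))//.
  by rewrite rl_mul_monol// leUr.
Qed.

Definition rl_equiv : rel A := fun a b => `[< F (a ⇔ b) >].

Lemma rl_equivP a b : reflect (F (a ⇒ b) /\ F (b ⇒ a)) (rl_equiv a b).
Proof. by apply: (iffP (asboolP _)) => /rl_filter_iff. Qed.

Lemma rl_equiv_refl : reflexive rl_equiv.
Proof. by move=> a; apply/rl_equivP; split; apply: rl_filter_le. Qed.

Lemma rl_equiv_sym : symmetric rl_equiv.
Proof. by move=> a b; apply/rl_equivP/rl_equivP => -[]. Qed.

Lemma rl_equiv_trans : transitive rl_equiv.
Proof.
move=> b a c /rl_equivP[ab ba] /rl_equivP[bc cb]; apply/rl_equivP.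
by split; apply: (@rl_filter_imp_trans b).
Qed.

Canonical rl_equiv_rel :=
  EquivRel rl_equiv rl_equiv_refl rl_equiv_sym rl_equiv_trans.

Definition rl_quot := {eq_quot rl_equiv_rel}.

HB.instance Definition _ := Choice.on rl_quot.
HB.instance Definition _ := EqQuotient.on rl_quot.

Definition rl_class (a : A) : rl_quot := \pi_rl_quot a.

Lemma rl_class_eq a b : (rl_class a = rl_class b) <-> F (a ⇔ b).
Proof.
by split=> [/eqquotP/asboolP//|Fab]; apply/eqquotP/asboolP.
Qed.

Lemma rl_classW (P : rl_quot -> Prop) :
  (forall a, P (rl_class a)) -> forall x, P x.
Proof. by move=> Pcl x; rewrite -[x]reprK; apply: Pcl. Qed.

Lemma repr_rl_class a :
  F (repr (rl_class a) ⇒ a) /\ F (a ⇒ repr (rl_class a)).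
Proof. by apply/rl_filter_iff/rl_class_eq; rewrite /rl_class reprK. Qed.

(* The operations and the order are given on representatives; the lemmas
   rl_class_* and le_rl_class below show that they do not depend on the choice
   of representatives, i.e. that rl_class is a surjective morphism. *)
Definition rl_quot_le (x y : rl_quot) : bool := `[< F (repr x ⇒ repr y) >].
Definition rl_quot_meet (x y : rl_quot) := rl_class (repr x `&` repr y).
Definition rl_quot_join (x y : rl_quot) := rl_class (repr x `|` repr y).
Definition rl_quot_mul (x y : rl_quot) := rl_class (repr x ⊙ repr y).
Definition rl_quot_imp (x y : rl_quot) := rl_class (repr x ⇒ repr y).

Lemma rl_quot_leP a b :
  reflect (F (a ⇒ b)) (rl_quot_le (rl_class a) (rl_class b)).
Proof.
have [ra ar] := repr_rl_class a; have [rb br] := repr_rl_class b.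
apply: (iffP (asboolP _)) => ab.
  exact: rl_filter_imp_trans (rl_filter_imp_trans ar ab) rb.
exact: rl_filter_imp_trans (rl_filter_imp_trans ra ab) br.
Qed.

Lemma rl_quot_le_refl : reflexive rl_quot_le.
Proof. by apply: rl_classW => a; apply/rl_quot_leP/rl_filter_le. Qed.

Lemma rl_quot_le_anti : antisymmetric rl_quot_le.
Proof.
apply: rl_classW => a; apply: rl_classW => b.
by case/andP=> /rl_quot_leP ab /rl_quot_leP ba; apply/rl_class_eq/rl_filter_iff.
Qed.

Lemma rl_quot_le_trans : transitive rl_quot_le.
Proof.
apply: rl_classW => b; apply: rl_classW => a; apply: rl_classW => c.
move=> /rl_quot_leP ab /rl_quot_leP bc; apply/rl_quot_leP.
exact: rl_filter_imp_trans ab bc.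
Qed.

HB.instance Definition _ := Order.Le_isPOrder.Build d rl_quot
  rl_quot_le_refl rl_quot_le_anti rl_quot_le_trans.

Lemma le_rl_class a b : (rl_class a <= rl_class b) <-> F (a ⇒ b).
Proof. by split=> /rl_quot_leP. Qed.

Lemma rl_quot_meetP x y z :
  (x <= rl_quot_meet y z) = (x <= y) && (x <= z).
Proof.
rewrite -[x]reprK -[y in RHS]reprK -[z in RHS]reprK.
apply/idP/andP => [/rl_quot_leP/rl_filter_imp_meet|] [xy xz].
  by split; apply/rl_quot_leP.
by apply/rl_quot_leP/rl_filter_imp_meet; split; apply/rl_quot_leP.
Qed.

Lemma rl_quot_joinP x y z :
  (rl_quot_join x y <= z) = (x <= z) && (y <= z).
Proof.
rewrite -[z]reprK -[x in RHS]reprK -[y in RHS]reprK.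
apply/idP/andP => [/rl_quot_leP/rl_filter_imp_join|] [xy xz].
  by split; apply/rl_quot_leP.
by apply/rl_quot_leP/rl_filter_imp_join; split; apply/rl_quot_leP.
Qed.

HB.instance Definition _ := Order.POrder_MeetJoin_isLattice.Build d rl_quot
  rl_quot_meetP rl_quot_joinP.

Lemma rl_quot_le0x x : rl_class \bot <= x.
Proof. by rewrite -[x]reprK; apply/le_rl_class/rl_filter_le/le0x. Qed.

Lemma rl_quot_lex1 x : x <= rl_class \top.
Proof. by rewrite -[x]reprK; apply/le_rl_class/rl_filter_le/lex1. Qed.

HB.instance Definition _ := Order.hasBottom.Build d rl_quot rl_quot_le0x.
HB.instance Definition _ := Order.hasTop.Build d rl_quot rl_quot_lex1.

Lemma rl_quot_mul_le a a' b : F (a ⇒ a') -> F (a ⊙ b ⇒ a' ⊙ b).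
Proof.
move=> aa'; apply: rl_filter_up aa' _.
by rewrite rl_residuation rl_mulA rl_mul_monor// rl_mp.
Qed.

Lemma rl_quot_mulE a b :
  rl_quot_mul (rl_class a) (rl_class b) = rl_class (a ⊙ b).
Proof.
have [ra ar] := repr_rl_class a; have [rb br] := repr_rl_class b.
apply/rl_class_eq/rl_filter_iff; split.
  apply: rl_filter_imp_trans (rl_quot_mul_le _ ra) _.
  by rewrite (rl_mulC a b) (rl_mulC a (repr _)); exact: rl_quot_mul_le.
apply: rl_filter_imp_trans (rl_quot_mul_le _ ar) _.
by rewrite (rl_mulC _ b) (rl_mulC _ (repr (rl_class b))); exact: rl_quot_mul_le.
Qed.

Lemma rl_quot_mulA : associative rl_quot_mul.
Proof.
apply: rl_classW => a; apply: rl_classW => b; apply: rl_classW => c.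
by rewrite !rl_quot_mulE rl_mulA.
Qed.

Lemma rl_quot_mulC : commutative rl_quot_mul.
Proof.
by apply: rl_classW => a; apply: rl_classW => b; rewrite !rl_quot_mulE rl_mulC.
Qed.

Lemma rl_quot_mul1 : left_id (\top : rl_quot) rl_quot_mul.
Proof.
by apply: rl_classW => a; rewrite [\top]/(rl_class \top) rl_quot_mulE rl_mul1.
Qed.

Lemma rl_quot_residuation (x y z : rl_quot) :
  (x <= rl_quot_imp y z) = (rl_quot_mul x y <= z).
Proof.
rewrite -[x]reprK -[z in RHS]reprK -[y in RHS]reprK.
rewrite -![\pi_ _ _]/(rl_class _) rl_quot_mulE.
by apply/idP/idP => /rl_quot_leP H; apply/rl_quot_leP; move: H;
   rewrite rl_imp_mul.
Qed.

HB.instance Definition _ := TBLattice_isResiduated.Build d rl_quot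
  rl_quot_mulA rl_quot_mulC rl_quot_mul1 rl_quot_residuation.

Lemma rl_class_bot : rl_class \bot = \bot.
Proof. by []. Qed.

Lemma rl_class_top : rl_class \top = \top.
Proof. by []. Qed.

Lemma rl_class_mul a b : rl_class (a ⊙ b) = rl_class a ⊙ rl_class b.
Proof. by rewrite -rl_quot_mulE. Qed.

Lemma rl_class_meet a b : rl_class (a `&` b) = rl_class a `&` rl_class b.
Proof.
apply/le_anti/andP; split.
  by rewrite lexI; apply/andP; split; apply/le_rl_class/rl_filter_le;
     rewrite ?leIl ?leIr.
move: (lexx (rl_class a `&` rl_class b)).
elim/rl_classW: {1 3}(_ `&` _) => c; rewrite lexI => /andP[/le_rl_class ca].
by move=> /le_rl_class cb; apply/le_rl_class/rl_filter_imp_meet.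
Qed.

Lemma rl_class_join a b : rl_class (a `|` b) = rl_class a `|` rl_class b.
Proof.
apply/le_anti/andP; split; last first.
  by rewrite leUx; apply/andP; split; apply/le_rl_class/rl_filter_le;
     rewrite ?leUl ?leUr.
move: (lexx (rl_class a `|` rl_class b)).
elim/rl_classW: {2 3}(_ `|` _) => c; rewrite leUx => /andP[/le_rl_class ac].
by move=> /le_rl_class bc; apply/le_rl_class/rl_filter_imp_join.
Qed.

Lemma rl_class_imp a b : rl_class (a ⇒ b) = rl_class a ⇒ rl_class b.
Proof.
apply/le_anti/andP; split.
  rewrite rl_residuation -rl_class_mul; apply/le_rl_class/rl_filter_le.
  exact: rl_mp.
move: (lexx (rl_class a ⇒ rl_class b)).
elim/rl_classW: {1 3}(_ ⇒ _) => c; rewrite rl_residuation -rl_class_mul.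
by move=> /le_rl_class cab; apply/le_rl_class; rewrite -rl_imp_mul.
Qed.

End Quotient.

Notation "A / F" := (@rl_quot _ A%type F) : type_scope.

Definition filter_BLP d (A : residuatedLatticeType d) (F : rl_filter A) : Prop :=
  forall f : A / F, \B(A / F) f -> exists2 e : A, \B(A) e & rl_class F e = f.

Definition BLP d (A : residuatedLatticeType d) : Prop :=
  forall F : rl_filter A, filter_BLP F.

(* The displays d i of the factors may differ; they carry no mathematical
   content, and the product gets a dummy one. *)
Section Product.
Variables (I : finType) (d : I -> Order.disp_t).
Variable A : forall i, residuatedLatticeType (d i).
Local Notation prodA := {dffun forall i : I, A i}.
Implicit Types f g h : prodA.

Definition rl_prod_le f g : bool := [forall i, f i <= g i].
Definition rl_prod_meet f g : prodA := [ffun i => f i `&` g i].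
Definition rl_prod_join f g : prodA := [ffun i => f i `|` g i].
Definition rl_prod_bot : prodA := [ffun=> \bot].
Definition rl_prod_top : prodA := [ffun=> \top].
Definition rl_prod_mul f g : prodA := [ffun i => f i ⊙ g i].
Definition rl_prod_imp f g : prodA := [ffun i => f i ⇒ g i].

Lemma rl_prod_le_refl : reflexive rl_prod_le.
Proof. by move=> f; apply/forallP. Qed.

Lemma rl_prod_le_anti : antisymmetric rl_prod_le.
Proof.
move=> f g /andP[/forallP fg /forallP gf]; apply/ffunP => i.
by apply/le_anti; rewrite fg gf.
Qed.

Lemma rl_prod_le_trans : transitive rl_prod_le.
Proof.
move=> g f h /forallP fg /forallP gh; apply/forallP => i.
exact: le_trans (fg i) (gh i).
Qed.

HB.instance Definition _ := Order.Le_isPOrder.Build (Order.Disp tt tt) prodA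
  rl_prod_le_refl rl_prod_le_anti rl_prod_le_trans.

Lemma rl_prod_meetP f g h : (f <= rl_prod_meet g h) = (f <= g) && (f <= h).
Proof.
apply/forallP/andP => [H|[/forallP fg /forallP fh] i].
  by split; apply/forallP => i; move: (H i); rewrite ffunE lexI => /andP[].
by rewrite ffunE lexI fg fh.
Qed.

Lemma rl_prod_joinP f g h : (rl_prod_join f g <= h) = (f <= h) && (g <= h).
Proof.
apply/forallP/andP => [H|[/forallP fh /forallP gh] i].
  by split; apply/forallP => i; move: (H i); rewrite ffunE leUx => /andP[].
by rewrite ffunE leUx fh gh.
Qed.

HB.instance Definition _ := Order.POrder_MeetJoin_isLattice.Build
  (Order.Disp tt tt) prodA rl_prod_meetP rl_prod_joinP.

Lemma rl_prod_le0x f : rl_prod_bot <= f.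
Proof. by apply/forallP => i; rewrite ffunE le0x. Qed.

Lemma rl_prod_lex1 f : f <= rl_prod_top.
Proof. by apply/forallP => i; rewrite ffunE lex1. Qed.

HB.instance Definition _ :=
  Order.hasBottom.Build (Order.Disp tt tt) prodA rl_prod_le0x.
HB.instance Definition _ :=
  Order.hasTop.Build (Order.Disp tt tt) prodA rl_prod_lex1.

Lemma rl_prod_mulA : associative rl_prod_mul.
Proof. by move=> f g h; apply/ffunP => i; rewrite !ffunE rl_mulA. Qed.

Lemma rl_prod_mulC : commutative rl_prod_mul.
Proof. by move=> f g; apply/ffunP => i; rewrite !ffunE rl_mulC. Qed.

Lemma rl_prod_mul1 : left_id (\top : prodA) rl_prod_mul.
Proof. by move=> f; apply/ffunP => i; rewrite !ffunE rl_mul1. Qed.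

Lemma rl_prod_residuation f g h :
  (f <= rl_prod_imp g h) = (rl_prod_mul f g <= h).
Proof. by apply: eq_forallb => i; rewrite !ffunE rl_residuation. Qed.

HB.instance Definition _ := TBLattice_isResiduated.Build
  (Order.Disp tt tt) prodA
  rl_prod_mulA rl_prod_mulC rl_prod_mul1 rl_prod_residuation.

End Product.

(* Main.v *)
Require Import Defs.
From mathcomp Require Import all_boot all_order.

(** The Boolean Lifting Property can be read off representatives: a filter [F]
    has BLP iff every pair [a, b] that is complementary modulo [F] admits a
    complemented [e] with [e ⇔ a] in [F] ([filter_BLPP]).

    A filter [Fi] of a factor gives a filter of the product, the preimage of
    [Fi] under the projection, and lifting there yields lifting for [Fi] by
    projecting the complemented element.

    Conversely, since the index set is finite, a filter of the product is the
    product of the filters it induces on the factors: [f] lies above the finite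
    meet of the elements that agree with [f] at one index and are [\top] at all
    others ([rl_prod_filterE]). Both being complementary modulo [F] and being
    congruent modulo [F] are therefore componentwise conditions, and so is
    being complemented in the product ([rl_prod_complemented]); componentwise
    liftings thus assemble into a lifting. *)

Import Order.TTheory.

Section Representatives.
Local Open Scope order_scope.
Local Open Scope rl_scope.
Variables (d : Order.disp_t) (A : residuatedLatticeType d) (F : rl_filter A).
Implicit Types a b : A.

Lemma rl_filter_meet a b : F a -> F b -> F (a `&` b).
Proof.
move=> Fa Fb; apply: (@rl_filter_up _ _ F (a ⊙ b)); first exact: rl_filter_mul.
by rewrite lexI rl_mul_lel rl_mul_ler.
Qed.

Lemma rl_class_complemented a :
  \B(A / F) (rl_class F a) <->
  exists b, F (a `&` b ⇒ \bot) /\ F (\top ⇒ a `|` b).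
Proof.
split=> [[y []]|[b [ab0 ab1]]].
  elim/rl_classW: y => b; rewrite -rl_class_meet -rl_class_join => ab0 ab1.
  exists b; split; apply/le_rl_class; first by rewrite ab0 rl_class_bot.
  by rewrite ab1 rl_class_top.
exists (rl_class F b); rewrite -rl_class_meet -rl_class_join; split.
  by apply/eqP; rewrite -lex0 -rl_class_bot; apply/le_rl_class.
by apply/eqP; rewrite -le1x -rl_class_top; apply/le_rl_class.
Qed.

Lemma filter_BLPP :
  filter_BLP F <->
  forall a b, F (a `&` b ⇒ \bot) -> F (\top ⇒ a `|` b) ->
    exists2 e, \B(A) e & F (e ⇔ a).
Proof.
split=> [blpF a b ab0 ab1|lift].
  have [|e Be ea] := blpF (rl_class F a).
    by apply/rl_class_complemented; exists b.
  by exists e => //; apply/rl_class_eq.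
elim/rl_classW => a /rl_class_complemented[b [ab0 ab1]].
have [e Be ea] := lift a b ab0 ab1.
by exists e => //; apply/rl_class_eq.
Qed.

End Representatives.

Section FiniteProduct.
Local Open Scope order_scope.
Local Open Scope rl_scope.
Variables (I : finType) (d : I -> Order.disp_t).
Variable A : forall i, residuatedLatticeType (d i).
Local Notation prodA := {dffun forall i : I, A i}.
Implicit Types f g : prodA.

Lemma rl_prod_leP f g : reflect (forall i, f i <= g i) (f <= g).
Proof. exact: forallP. Qed.

Lemma rl_prod_mulE f g i : (f ⊙ g) i = f i ⊙ g i.
Proof. by rewrite ffunE. Qed.

Lemma rl_prod_impE f g i : (f ⇒ g) i = f i ⇒ g i.
Proof. by rewrite ffunE. Qed.

Lemma rl_prod_meetE f g i : (f `&` g) i = f i `&` g i.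
Proof. by rewrite ffunE. Qed.

Lemma rl_prod_joinE f g i : (f `|` g) i = f i `|` g i.
Proof. by rewrite ffunE. Qed.

Lemma rl_prod_botE i : (\bot : prodA) i = \bot.
Proof. by rewrite ffunE. Qed.

Lemma rl_prod_topE i : (\top : prodA) i = \top.
Proof. by rewrite ffunE. Qed.

Lemma rl_prod_iffE f g i : (f ⇔ g) i = f i ⇔ g i.
Proof. by rewrite rl_prod_meetE !rl_prod_impE. Qed.

Lemma rl_prod_complemented f : \B(prodA) f <-> forall i, \B(A i) (f i).
Proof.
split=> [[g [fg0 fg1]] i|Bf].
  exists (g i).
  by rewrite -rl_prod_meetE -rl_prod_joinE fg0 fg1 rl_prod_botE rl_prod_topE.
have [g gP] := fin_all_exists Bf.
by exists [ffun i => g i]; split; apply/ffunP => i;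
   rewrite !ffunE; case: (gP i).
Qed.

(** The element with [i]-th component [x] and all other components [\top]. *)
Definition rl_prod_inj i (x : A i) : prodA :=
  [ffun j => dfwith (fun k => \top : A k) x j].

Lemma rl_prod_inj_in i (x : A i) : rl_prod_inj i x i = x.
Proof. by rewrite ffunE dfwith_in. Qed.

Lemma rl_prod_inj_out i (x : A i) j : i != j -> rl_prod_inj i x j = \top.
Proof. by move=> ij; rewrite ffunE dfwith_out. Qed.

Lemma le_rl_prod_inj f i (x : A i) : (f <= rl_prod_inj i x) = (f i <= x).
Proof.
apply/rl_prod_leP/idP => [/(_ i)|fx j]; first by rewrite rl_prod_inj_in.
have [<-|ij] := eqVneq i j; first by rewrite rl_prod_inj_in.
by rewrite rl_prod_inj_out// lex1.
Qed.

Section ProjectionPreimage.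
Variables (i : I) (Fi : rl_filter (A i)).

Let preim f := Fi (f i).

Let preim_nonempty : exists f, preim f.
Proof. by exists \top; rewrite /preim rl_prod_topE; exact: rl_filter_top. Qed.

Let preim_mul f g : preim f -> preim g -> preim (f ⊙ g).
Proof. by rewrite /preim rl_prod_mulE; exact: rl_filter_mul. Qed.

Let preim_up f g : preim f -> f <= g -> preim g.
Proof. by move=> Ff /rl_prod_leP fg; exact: rl_filter_up Ff (fg i). Qed.

(** The preimage of the filter [Fi] of the factor [A i] under the [i]-th
    projection. *)
Definition rl_filter_preim : rl_filter prodA :=
  RLFilter preim_nonempty preim_mul preim_up.

End ProjectionPreimage.

Section FactorFilter.
Variables (F : rl_filter prodA) (i : I).

Let factor x := F (rl_prod_inj i x).

Let factor_nonempty : exists x, factor x.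
Proof.
exists \top; apply: rl_filter_up (rl_filter_top F) _.
by rewrite le_rl_prod_inj lex1.
Qed.

Let factor_mul x y : factor x -> factor y -> factor (x ⊙ y).
Proof.
move=> Fx Fy; apply: rl_filter_up (rl_filter_mul Fx Fy) _.
by rewrite le_rl_prod_inj rl_prod_mulE !rl_prod_inj_in.
Qed.

Let factor_up x y : factor x -> x <= y -> factor y.
Proof.
by move=> Fx xy; apply: rl_filter_up Fx _; rewrite le_rl_prod_inj rl_prod_inj_in.
Qed.

(** The filter induced on the factor [A i] by a filter [F] of the product: the
    [x] such that [F] contains the element with [i]-th component [x] and all
    other components [\top]. *)
Definition rl_filter_factor : rl_filter (A i) :=
  RLFilter factor_nonempty factor_mul factor_up.

End FactorFilter.

(** Finiteness of the index set is essential here: the elements of a direct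
    product that are [\top] outside a finite set of indices form a filter,
    which is proper in general but induces the improper filter on each
    factor. *)
Lemma rl_prod_filterE (F : rl_filter prodA) f :
  F f <-> forall i, rl_filter_factor F i (f i).
Proof.
split=> [Ff i|Ff]; first by apply: rl_filter_up Ff _; rewrite le_rl_prod_inj.
apply: (@rl_filter_up _ _ F (\meet_i rl_prod_inj i (f i))).
  apply: big_ind => [||i _]; [exact: rl_filter_top|exact: rl_filter_meet|].
  exact: Ff.
by apply/rl_prod_leP => i; rewrite -le_rl_prod_inj meets_inf.
Qed.

Lemma BLP_factor : BLP prodA -> forall i, BLP (A i).
Proof.
move=> blpA i Fi; apply/filter_BLPP => a b ab0 ab1.
(* The components other than the i-th are irrelevant modulo the preimage of
   Fi. *)
have [| |e /rl_prod_complemented Be] :=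
    proj1 (filter_BLPP _ _ (rl_filter_preim i Fi)) (blpA _)
      (rl_prod_inj i a) (rl_prod_inj i b).
- by rewrite /= rl_prod_impE rl_prod_meetE rl_prod_botE !rl_prod_inj_in.
- by rewrite /= rl_prod_impE rl_prod_joinE rl_prod_topE !rl_prod_inj_in.
by rewrite /= rl_prod_iffE rl_prod_inj_in => ea; exists (e i).
Qed.

Lemma BLP_prod : (forall i, BLP (A i)) -> BLP prodA.
Proof.
move=> blpA F; apply/filter_BLPP => a b /rl_prod_filterE ab0.
move=> /rl_prod_filterE ab1.
have lift i : exists e : A i, \B(A i) e /\ rl_filter_factor F i (e ⇔ a i).
  have [| |e Be ea] :=
      proj1 (filter_BLPP _ _ (rl_filter_factor F i)) (blpA i _) (a i) (b i).
  - by move: (ab0 i); rewrite rl_prod_impE rl_prod_meetE rl_prod_botE.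
  - by move: (ab1 i); rewrite rl_prod_impE rl_prod_joinE rl_prod_topE.
  by exists e.
have [e eP] := fin_all_exists lift.
exists [ffun i => e i].
  by apply/rl_prod_complemented => i; rewrite ffunE; case: (eP i).
apply/rl_prod_filterE => i; rewrite rl_prod_iffE ffunE.
by case: (eP i).
Qed.

End FiniteProduct.

Theorem proposition5p4 (n : nat) (hn : 1 <= n)
    (d : 'I_n -> Order.disp_t) (A : forall i : 'I_n, residuatedLatticeType (d i)) :
  BLP {dffun forall i : 'I_n, A i} <-> forall i : 'I_n, BLP (A i).
Proof. by split; [exact: BLP_factor|exact: BLP_prod]. Qed.
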